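(* Let $f:\mathbb{R}^n\to\mathbb{R}$ be a SOS-convex polynomial and, for $i=1,\ldots,m$, let $g_i:\mathbb{R}^n\times\mathbb{R}^{q_i}\to\mathbb{R}$ be a function such that for each $v_i\in\mathbb{R}^{q_i}$, $g_i(\cdot,v_i)$ is a SOS-convex polynomial with degree at most $d_i$. Let $\mathcal{V}_i\subset\mathbb{R}^{q_i}$, $i=1,\ldots,m$, be compact and let $$F:=\{x\in\mathbb{R}^n : g_i(x,v_i)\le 0\ \ \forall v_i\in\mathcal{V}_i,\ i=1,\ldots,m\}\neq\emptyset.$$ Suppose that $\operatorname{argmin}_{x\in F} f(x)\neq\emptyset$ and that the normal cone condition holds for $F$ at $x^*\in F$. Let $k_0$ be the smallest even number such that $k_0\ge\max\{\deg f,\max_{1\le i\le m} d_i\}$. Then $x^*$ is a minimizer of $\min_{x\in F} f(x)$ if and only if there exist $\bar v_i\in\mathcal{V}_i$ and $\lambda_i\ge 0$, $i=1,\ldots,m$, and $\sigma_0\in\Sigma^2_{k_0}$ such that $$f(x)-f(x^* )+\sum_{i=1}^m\lambda_i g_i(x,\bar v_i)=\sigma_0(x)\quad\text{for all }x\in\mathbb{R}^n.$$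
   Context: A matrix polynomial $M\in\mathbb{R}[x]^{n\times n}$ is a SOS matrix polynomial if $M(x)=H(x)H(x)^T$ for some matrix polynomial $H\in\mathbb{R}[x]^{n\times r}$, $r\in\mathbb{N}$. A real polynomial $f$ on $\mathbb{R}^n$ is SOS-convex if its Hessian $x\mapsto\nabla^2 f(x)$ is a SOS matrix polynomial. $\Sigma^2_d$ denotes the set of all real polynomials of degree at most $d$ that are sums of squares of real polynomials. For a convex set $A$ and $x\in A$, the normal cone is $N_A(x):=\{v\in\mathbb{R}^n : v^T(y-x)\le 0\ \forall y\in A\}$. The normal cone condition holds for $F$ at $x\in F$ if $$N_F(x)=\Big\{\sum_{i=1}^m\lambda_i\nabla_x g_i(x,v_i) : \lambda_i\ge 0,\ v_i\in\mathcal{V}_i,\ \lambda_i g_i(x,v_i)=0,\ i=1,\ldots,m\Big\},$$ where $\nabla_x$ denotes the gradient with respect to $x$. *)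

(* Defs.v *)
From mathcomp Require Import all_boot all_order all_algebra.
From mathcomp Require mpoly.
(* The notations of [mpoly] clash with those of [all_analysis]. *)
Import -(notations) mpoly.
From mathcomp Require Import all_classical all_reals all_analysis.
Set Implicit Arguments.
Unset Strict Implicit.
Unset Printing Implicit Defensive.

Import Order.TTheory GRing.Theory Num.Theory.
Import numFieldNormedType.Exports.
Local Open Scope classical_set_scope.
Local Open Scope ring_scope.

(* Real polynomials on R^n are elements of [mpoly n R], i.e. R[x_1, .., x_n];
   as R is infinite they are in bijection with the polynomial functions on R^n.
   Points of R^n are row vectors. *)
Section Polynomials.
Variables (R : realType) (n : nat).
Implicit Types (p : mpoly n R) (x : 'rV[R]_n).

Definition peval p x : R := meval (fun i => x 0 i) p.

(* [mmeasure mdeg p] is multinomials' [msize p], one more than the total degree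
   of p; the zero polynomial gets degree 0. *)
Definition pdeg p : nat := (mmeasure (@mdeg n) p).-1.

Definition gradient p x : 'rV[R]_n := \row_i peval (mderiv i p) x.

Definition hessian p : 'M[mpoly n R]_n :=
  \matrix_(i, j) mderiv j (mderiv i p).

Definition sos_matrix k (M : 'M[mpoly n R]_k) : Prop :=
  exists (r : nat) (H : 'M[mpoly n R]_(k, r)), M = H *m H^T.

Definition sos_convex p : Prop := sos_matrix (hessian p).

Definition sos_deg_le (d : nat) : set (mpoly n R) :=
  [set p | (pdeg p <= d)%N /\
           exists s : seq (mpoly n R), p = \sum_(h <- s) h ^+ 2].

Definition argmin (A : set 'rV[R]_n) p : set 'rV[R]_n :=
  [set x | A x /\ forall y, A y -> peval p x <= peval p y].

Definition normal_cone (A : set 'rV[R]_n) x : set 'rV[R]_n :=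
  [set v | forall y, A y -> (v *m (y - x)^T) 0 0 <= 0].

Variables (m : nat) (q : 'I_m -> nat).
Variables (g : forall i, 'rV[R]_(q i) -> mpoly n R).
Variables (V : forall i, set 'rV[R]_(q i)).

Definition feasible : set 'rV[R]_n :=
  [set x | forall i v, V v -> peval (@g i v) x <= 0].

Definition multiplier_cone x : set 'rV[R]_n :=
  [set u | exists (lambda : 'I_m -> R) (v : forall i, 'rV[R]_(q i)),
     (forall i, [/\ 0 <= lambda i, V (v i)
                  & lambda i * peval (g (v i)) x = 0]) /\
     u = \sum_i lambda i *: gradient (g (v i)) x].

Definition normal_cone_condition x : Prop :=
  normal_cone feasible x = multiplier_cone x.

End Polynomials.

Definition smallest_even_ge (N k : nat) : Prop :=
  [/\ ~~ odd k, (N <= k)%N & forall l, ~~ odd l -> (N <= l)%N -> (k <= l)%N].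

(* Main.v *)
Require Import Defs.
From mathcomp Require Import all_boot all_order all_algebra.
From mathcomp Require mpoly.
Import -(notations) mpoly.
From mathcomp Require Import all_classical all_reals all_analysis.
From mathcomp Require Import ring lra.
Set Implicit Arguments.
Unset Strict Implicit.
Unset Printing Implicit Defensive.
Import Order.TTheory GRing.Theory Num.Theory.
Import numFieldNormedType.Exports.
Local Open Scope classical_set_scope.
Local Open Scope ring_scope.

(** The only substantial point is that, for an SOS-convex polynomial [p] and
    any point [x], the first-order Taylor remainder
      p(X) - p(x) - grad p(x) . (X - x)
    is a sum of squares of polynomials ([sos_taylor1_rest]).  Everything else
    is convex duality at [xs].

    Analytically, this remainder is the integral over [0, 1] of
    (1 - t) (X - x)^T (hess p)(x + t (X - x)) (X - x).  If hess p = H H^T, the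
    integrand is a sum of squares W_k(t)^2 of polynomials in t, weighted by
    1 - t; expanding in powers of t, the integral is a sum over k of
    quadratic forms in the coefficients of W_k, with matrix 1 / ((a + b + 1) (a + b + 2)).  No
    integral is needed to say this: P(t) = p(x + t (X - x)) is a univariate
    polynomial with coefficients in R[X], the chain rule gives
    P'' = sum_k W_k^2, and P(1) - P_0 - P_1 is read off from the coefficients
    of P''.  It remains to see that the matrix is a Gram matrix.  It is the
    entrywise product of the two Cauchy matrices 1 / (x_a + x_b) with
    x_a = a + 1 and x_a = a + 1/2, and Cauchy matrices with positive nodes are
    Gram matrices: the Schur complement of a pivot is again the same Cauchy
    matrix, up to a diagonal scaling ([cauchy_kernel_gram]).

    A sum of squares being nonnegative, SOS-convex polynomials lie above their
    tangents.  Hence their sublevel sets, and so the feasible set F, are convex;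
    and if [xs] minimizes [f] over F, then [- grad f(xs)] is in the normal cone
    of F at [xs].  The normal cone condition provides multipliers with
    grad f(xs) + sum_i lambda_i grad g_i(xs, v_i) = 0 and
    lambda_i g_i(xs, v_i) = 0.  These relations cancel the affine terms in the
    combination of the Taylor remainders of [f] and of the [g_i], so that the
    Lagrangian f - f(xs) + sum_i lambda_i g_i is itself that combination,
    a sum of squares.  The converse is weak duality. *)

(** * Sums of squares *)

Definition sos (A : comNzRingType) (a : A) : Prop :=
  exists s : seq A, a = \sum_(h <- s) h ^+ 2.

Lemma sos_sqr (A : comNzRingType) (a : A) : sos (a ^+ 2).
Proof. by exists [:: a]; rewrite big_seq1. Qed.

Lemma sosD (A : comNzRingType) (a b : A) : sos a -> sos b -> sos (a + b).
Proof. by move=> [s ->] [t ->]; exists (s ++ t); rewrite big_cat. Qed.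

Lemma sos_sum (A : comNzRingType) (I : Type) (r : seq I) (F : I -> A) :
  (forall i, sos (F i)) -> sos (\sum_(i <- r) F i).
Proof.
move=> sosF; apply: big_rec => [|i a _ sos_a]; last exact: sosD.
by exists [::]; rewrite big_nil.
Qed.

Lemma sosZ (R : rcfType) (A : comAlgType R) (c : R) (a : A) :
  0 <= c -> sos a -> sos (c *: a).
Proof.
move=> c0 [s ->]; rewrite scaler_sumr; apply: sos_sum => h.
by rewrite -(sqr_sqrtr c0) -exprZn; apply: sos_sqr.
Qed.

(** * The Cauchy kernel and twofold integration *)

(** Gaussian elimination with the last node x_N as pivot rests on
      1 / (x_i + x_j) = 2 x_N / ((x_i + x_N) (x_j + x_N))
                        + s_i s_j / (x_i + x_j),
    where s_i = (x_i - x_N) / (x_i + x_N).  The first term is a rank-one square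
    because x_N > 0.  As s_N = 0, only the nodes before N matter in the second,
    to which the induction hypothesis applies. *)
Lemma cauchy_kernel_gram (R : rcfType) (N : nat) (x : nat -> R) :
  (forall i, 0 < x i) ->
  exists s : seq (nat -> R), forall i j, (i < N)%N -> (j < N)%N ->
    (x i + x j)^-1 = \sum_(l <- s) l i * l j.
Proof.
move=> x0; elim: N => [|N [s IH]]; first by exists [::].
pose l0 i := Num.sqrt (x N *+ 2) / (x i + x N).
pose up l : nat -> R := fun i => (x i - x N) / (x i + x N) * l i.
exists (l0 :: map up s) => i j; rewrite !ltnS => iN jN.
have xij k k' : x k + x k' != 0 by rewrite gt_eqF ?addr_gt0.
have sqE : Num.sqrt (x N *+ 2) * Num.sqrt (x N *+ 2) = x N *+ 2.
  by rewrite -expr2 sqr_sqrtr// mulrn_wge0// ltW.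
have l0E : l0 i * l0 j = x N *+ 2 / ((x i + x N) * (x j + x N)).
  by rewrite /l0 mulrACA sqE -invfM.
rewrite big_cons big_map l0E /up /=.
rewrite (eq_bigr (fun l : nat -> R => (x i - x N) / (x i + x N) *
    ((x j - x N) / (x j + x N)) * (l i * l j))); last first.
  by move=> l _; rewrite mulrACA.
rewrite -mulr_sumr.
have [ltiN|] := ltnP i N; have [ltjN|] := ltnP j N.
- by rewrite -(IH i j)//; field; rewrite !xij.
- move=> Nj; have -> : j = N by apply/eqP; rewrite eqn_leq jN.
  by rewrite subrr !(mul0r, mulr0) addr0; field; rewrite !xij.
- move=> Ni; have -> : i = N by apply/eqP; rewrite eqn_leq iN.
  by rewrite subrr !(mul0r, mulr0) addr0; field; rewrite !xij.
- move=> _ Ni; have -> : i = N by apply/eqP; rewrite eqn_leq iN.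
  by rewrite subrr !(mul0r, mulr0) addr0; field; rewrite !xij.
Qed.

(** Integrating t ^ c twice from 0, and evaluating the result at 1. *)
Definition prim2_coef (R : rcfType) (c : nat) : R := (c.+2%:R * c.+1%:R)^-1.

(** The weight of the pair (a, b) factors as
    1 / ((a + 1) + (b + 1)) * 1 / ((a + 1/2) + (b + 1/2)), and an entrywise
    product of Gram matrices is a Gram matrix: if the factors are
    sum_l l(a) l(b) and sum_k k(a) k(b), the form is the sum over l, k of the
    squares of sum_a l(a) k(a) w(a). *)
Lemma prim2_form_sos (R : rcfType) (A : comAlgType R) (N : nat) (w : nat -> A) :
  sos (\sum_(a < N) \sum_(b < N) prim2_coef R (a + b) *: (w a * w b)).
Proof.
have [s sE] := @cauchy_kernel_gram R N (fun a => a.+1%:R) (fun=> ltr0Sn _ _).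
have half0 a : 0 < a%:R + 2^-1 :> R by rewrite ltr_wpDl ?ler0n ?invr_gt0 ?ltr0n.
have [t tE] := @cauchy_kernel_gram R N (fun a => a%:R + 2^-1) half0.
rewrite [X in sos X](_ : _ = \sum_(l <- s) \sum_(k <- t)
    (\sum_(a < N) (l a * k a) *: w a) ^+ 2).
  by apply: sos_sum => l; apply: sos_sum => k; apply: sos_sqr.
transitivity (\sum_(a < N) \sum_(b < N) \sum_(l <- s) \sum_(k <- t)
    ((l a * k a) *: w a) * ((l b * k b) *: w b)).
  apply: eq_bigr => a _; apply: eq_bigr => b _.
  have -> : prim2_coef R (a + b) =
      (a.+1%:R + b.+1%:R)^-1 * (a%:R + 2^-1 + (b%:R + 2^-1))^-1.
    rewrite /prim2_coef invfM; congr (_^-1 * _^-1).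
      by rewrite -natrD addSn addnS.
    by rewrite -natr1 natrD; field.
  rewrite sE ?tE// big_distrl scaler_suml; apply: eq_bigr => l _ /=.
  rewrite big_distrr scaler_suml; apply: eq_bigr => k _ /=.
  by rewrite mulrACA -(scalerA (l a * k a)) [in LHS]scalerAr [in LHS]scalerAl.
under eq_bigr do rewrite exchange_big.
rewrite exchange_big; apply: eq_bigr => l _ /=.
under eq_bigr do rewrite exchange_big.
rewrite exchange_big; apply: eq_bigr => k _ /=.
rewrite expr2 big_distrl; apply: eq_bigr => a _ /=.
by rewrite big_distrr.
Qed.

Lemma double_primitive (R : rcfType) (A : comAlgType R)
    (P : {poly A}) (N : nat) :
  (size P <= N.+2)%N ->
  P.[1] - P`_0 - P`_1 = \sum_(c < N) prim2_coef R c *: (P^`()^`())`_c.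
Proof.
move=> sP; rewrite (horner_coef_wide _ sP) !big_ord_recl /= !expr1n !mulr1.
set S := \sum_(i < N) _; have -> : P`_0 + (P`_1 + S) - P`_0 - P`_1 = S by ring.
apply: eq_bigr => c _; rewrite !coef_deriv -mulrnA -scaler_nat scalerA.
by rewrite /prim2_coef -natrM mulnC mulVf ?scale1r ?expr1n ?mulr1// pnatr_eq0.
Qed.

Lemma sum_gram (A : comNzRingType) (I K : finType) (F : I -> K -> A) :
  \sum_i \sum_j \sum_k F i k * F j k = \sum_k (\sum_i F i k) ^+ 2.
Proof.
under eq_bigr do rewrite exchange_big.
rewrite exchange_big; apply: eq_bigr => k _ /=.
by under eq_bigr do rewrite -mulr_sumr; rewrite -mulr_suml.
Qed.

Lemma prim2_coef_sqr (R : rcfType) (A : comAlgType R) (W : {poly A}) (N : nat) :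
  ((size W).*2 <= N)%N ->
  \sum_(c < N) prim2_coef R c *: (W ^+ 2)`_c =
  \sum_(a < size W) \sum_(b < size W) prim2_coef R (a + b) *: (W`_a * W`_b).
Proof.
move=> sN; have W2E c : (W ^+ 2)`_c =
    \sum_(a < size W) \sum_(b < size W) (W`_a * W`_b) *+ (c == a + b)%N.
  rewrite expr2 -{1 2}[W]coefK poly_def mulr_suml coef_sum.
  apply: eq_bigr => a _; rewrite mulr_sumr coef_sum; apply: eq_bigr => b _.
  by rewrite -scalerAl -scalerAr scalerA -exprD coefZ coefXn mulr_natr.
under eq_bigr => c _.
  rewrite W2E scaler_sumr; under eq_bigr do rewrite scaler_sumr.
over.
rewrite exchange_big; apply: eq_bigr => a _ /=.
rewrite exchange_big; apply: eq_bigr => b _ /=.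
have abN : (a + b < N)%N.
  by rewrite (leq_trans _ sN)// -addnn -addSn leq_add// ltnW.
rewrite (bigD1 (Ordinal abN))//= eqxx mulr1n big1 ?addr0// => c.
by rewrite -val_eqE /= => /negPf ->; rewrite mulr0n scaler0.
Qed.

(** The Taylor remainder of [P] between 0 and 1 is the twofold integral of
    [P''], and the twofold integral of one [W k ^+ 2] is the form of
    [prim2_form_sos] in the coefficients of [W k]. *)
Lemma poly_taylor_rest_sos (R : rcfType) (A : comAlgType R) (r : nat)
    (P : {poly A}) (W : 'I_r -> {poly A}) :
  P^`()^`() = \sum_k W k ^+ 2 -> sos (P.[1] - P`_0 - P`_1).
Proof.
move=> P2; pose N := (size P + \sum_k (size (W k)).*2)%N.
have sP : (size P <= N.+2)%N by rewrite !leqW ?leq_addr.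
rewrite (double_primitive sP) P2.
under eq_bigr do rewrite coef_sum scaler_sumr.
rewrite exchange_big; apply: sos_sum => k /=.
rewrite prim2_coef_sqr; first exact: (prim2_form_sos _ (fun a => (W k)`_a)).
by rewrite /N (bigD1 k)//= addnCA leq_addr.
Qed.

(** * Restriction of a polynomial to a line *)

Section Line.
Variables (R A : comNzRingType) (iota : {rmorphism R -> A}) (n : nat).
Variables (u v : 'I_n -> A).

(** The univariate polynomial p(u + t v).  The base point and the direction have
    coordinates in a commutative ring [A] over [R], because two cases are used:
    [A] = [R] for a segment between two points, and [A] = R[X] for the segment
    from a fixed point to the generic point [X]. *)
Definition line (p : mpoly n R) : {poly A} :=
  mmap (polyC \o iota) (fun i => (u i)%:P + (v i)%:P * 'X) p.

Lemma lineM p q : line (p * q) = line p * line q.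
Proof. exact: rmorphM. Qed.

Lemma line_sum (I : Type) (r : seq I) (F : I -> mpoly n R) :
  line (\sum_(k <- r) F k) = \sum_(k <- r) line (F k).
Proof. exact: raddf_sum. Qed.

Lemma horner_line p (t : A) :
  (line p).[t] = mmap iota (fun i => u i + v i * t) p.
Proof.
rewrite /line /mmap horner_sum; apply: eq_bigr => M _.
rewrite hornerM /= hornerC /mmap1 horner_prod; congr (_ * _).
by apply: eq_bigr => i _; rewrite horner_exp !hornerE.
Qed.

(** Both sides of the chain rule are derivations above the ring morphism [line],
    so it suffices to compare them on constants and on variables. *)
Let chain p := (line p)^`() = \sum_i (v i)%:P * line (mderiv i p).

Let chainC c : chain (mpolyC n c).
Proof.
rewrite /chain /line mmapC derivC big1// => i _.
by rewrite mderivC mmap0 mulr0.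
Qed.

Let chainX j : chain (mpolyX R (mnm1 j)).
Proof.
rewrite /chain /line mmapX mmap1U (bigD1 j)//= big1 => [|i ij].
  rewrite mderivX mnm1E eqxx scale1r -[X in mnm_sub X]add0m addmK mpolyX0.
  rewrite rmorph1.
  by rewrite derivD derivC derivM derivC derivX !(mul0r, add0r, addr0, mulr1).
by rewrite mderivX mnm1E eq_sym (negPf ij) scale0r mmap0 mulr0.
Qed.

Let chainD p q : chain p -> chain q -> chain (p + q).
Proof.
rewrite /chain /line => Hp Hq; rewrite mmapD derivD Hp Hq -big_split.
by apply: eq_bigr => i _; rewrite mderivD mmapD mulrDr.
Qed.

Let chainM p q : chain p -> chain q -> chain (p * q).
Proof.
rewrite /chain /line => Hp Hq; rewrite rmorphM derivM Hp Hq.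
rewrite mulr_suml mulr_sumr -big_split; apply: eq_bigr => i _ /=.
rewrite mderivM rmorphD !rmorphM /=; ring.
Qed.

Lemma deriv_line p : (line p)^`() = \sum_i (v i)%:P * line (mderiv i p).
Proof.
have chain1 : chain 1 by have := chainC 1; rewrite rmorph1.
elim/mpolyind: p => [|c M p _ _ IH]; first by have := chainC 0; rewrite rmorph0.
apply: chainD => //; rewrite -mul_mpolyC; apply: chainM => //.
rewrite mpolyXE_id; apply: big_ind => // i _.
by elim: (M i) => [|k IHk]; rewrite ?expr0 // exprS; apply: chainM.
Qed.

Lemma line_coef0 p : (line p)`_0 = mmap iota u p.
Proof.
rewrite -horner_coef0 horner_line; congr mmap.
by apply: funext => i; rewrite mulr0 addr0.
Qed.

Lemma line_coef1 p : (line p)`_1 = \sum_i v i * mmap iota u (mderiv i p).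
Proof.
transitivity ((line p)^`()`_0); first by rewrite coef_deriv.
rewrite deriv_line coef_sum; apply: eq_bigr => i _.
by rewrite coefCM line_coef0.
Qed.

End Line.

(** * The Taylor remainder of an SOS-convex polynomial *)

Section TaylorRest.
Variables (R : realType) (n : nat).
Implicit Types (p : mpoly n R) (x y : 'rV[R]_n).

Lemma mmap_mpolyC p (u : 'I_n -> R) :
  mmap (@mpolyC n R) (fun i => mpolyC n (u i)) p = mpolyC n (meval u p).
Proof.
rewrite /meval /mmap rmorph_sum; apply: eq_bigr => M _ /=.
rewrite rmorphM /mmap1 rmorph_prod; congr (_ * _).
by apply: eq_bigr => i _; rewrite rmorphXn.
Qed.

Lemma mmap_mpolyX p : mmap (@mpolyC n R) (fun i => mpolyX R (mnm1 i)) p = p.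
Proof.
rewrite [RHS]mpolyE /mmap.
by under eq_bigr do rewrite mmap1_id mul_mpolyC.
Qed.

Definition linear_form x (u : 'rV[R]_n) : mpoly n R :=
  \sum_i u 0 i *: (mpolyX R (mnm1 i) - mpolyC n (x 0 i)).

Lemma linear_formD x : {morph linear_form x : u w / u + w}.
Proof.
by move=> u w; rewrite -big_split; apply: eq_bigr => j _; rewrite mxE scalerDl.
Qed.

Lemma linear_formZ x c u : linear_form x (c *: u) = c *: linear_form x u.
Proof.
by rewrite scaler_sumr; apply: eq_bigr => j _; rewrite mxE scalerA.
Qed.

Lemma linear_form0 x : linear_form x 0 = 0.
Proof. by rewrite -(scale0r 0) linear_formZ scale0r. Qed.

Definition taylor1_rest p x : mpoly n R :=
  p - mpolyC n (peval p x) - linear_form x (gradient p x).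

Lemma peval_taylor1_rest p x y :
  peval (taylor1_rest p x) y =
  peval p y - peval p x - (gradient p x *m (y - x)^T) 0 0.
Proof.
rewrite /peval /taylor1_rest /linear_form !mevalB mevalC mxE.
rewrite [meval _ (\sum_i _)]raddf_sum; congr (_ - _).
by apply: eq_bigr => i _ /=; rewrite mevalZ mevalB mevalC mevalXU !mxE.
Qed.

(** Along the line from [x] to the generic point X, the second derivative of [p]
    is sum_(i, j) v_i v_j (H H^T)_(i, j) with v = X - x, that is,
    sum_k (sum_i v_i H_(i, k)) ^ 2; the value of this restriction at t = 1 is
    [p] itself, and its two lowest coefficients form the tangent of [p] at
    [x]. *)
Lemma sos_taylor1_rest p x : sos_convex p -> sos (taylor1_rest p x).
Proof.
move=> [r [H hessE]].
pose v (i : 'I_n) := mpolyX R (mnm1 i) - mpolyC n (x 0 i).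
pose L := line (@mpolyC n R) (fun i => mpolyC n (x 0 i)) v.
have L1 : (L p).[1] = p.
  rewrite horner_line -[RHS]mmap_mpolyX; congr mmap.
  by apply: funext => i; rewrite mulr1 addrC subrK.
have Lc0 : (L p)`_0 = mpolyC n (peval p x) by rewrite line_coef0 mmap_mpolyC.
have Lc1 : (L p)`_1 = \sum_i gradient p x 0 i *: v i.
  rewrite line_coef1; apply: eq_bigr => i _.
  by rewrite mmap_mpolyC mulrC mul_mpolyC mxE.
rewrite /taylor1_rest /linear_form -Lc0 -/v -Lc1 -{1}L1.
apply: (@poly_taylor_rest_sos _ _ r _ (fun k => \sum_i (v i)%:P * L (H i k))).
rewrite deriv_line [deriv _]raddf_sum /=.
transitivity (\sum_i \sum_j \sum_(k < r)
    ((v i)%:P * L (H i k)) * ((v j)%:P * L (H j k))).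
  apply: eq_bigr => i _; rewrite derivM derivC mul0r add0r deriv_line mulr_sumr.
  apply: eq_bigr => j _.
  have -> : mderiv j (mderiv i p) = \sum_k H i k * H j k.
    have := congr1 (fun M : 'M[mpoly n R]_n => M i j) hessE; rewrite !mxE => ->.
    by apply: eq_bigr => k _; rewrite mxE.
  rewrite /L line_sum 2!mulr_sumr; apply: eq_bigr => k _.
  by rewrite lineM [RHS]mulrACA -!mulrA.
exact: (sum_gram (fun i k => (v i)%:P * L (H i k))).
Qed.

(** At a stationary point of the Lagrangian with complementary slackness, the
    affine parts of the remainders cancel. *)
Lemma taylor1_rest_lagrangian m (f : mpoly n R) (h : 'I_m -> mpoly n R)
    (lam : 'I_m -> R) x :
  gradient f x + \sum_i lam i *: gradient (h i) x = 0 ->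
  (forall i, lam i * peval (h i) x = 0) ->
  taylor1_rest f x + \sum_i lam i *: taylor1_rest (h i) x =
  f - mpolyC n (peval f x) + \sum_i lam i *: h i.
Proof.
move=> grad0 slack.
have rest_h i : lam i *: taylor1_rest (h i) x =
    lam i *: h i - linear_form x (lam i *: gradient (h i) x).
  rewrite !scalerBr linear_formZ -[_ *: mpolyC _ _]mul_mpolyC -rmorphM slack.
  by rewrite rmorph0 subr0.
rewrite (eq_bigr _ (fun i _ => rest_h i)) sumrB.
rewrite -(big_morph _ (linear_formD x) (linear_form0 x)) /taylor1_rest.
by rewrite addrACA -opprD -linear_formD grad0 linear_form0 subr0.
Qed.

Lemma peval_sos_ge0 p x : sos p -> 0 <= peval p x.
Proof.
move=> [s ->]; rewrite /peval raddf_sum sumr_ge0// => h _ /=.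
by rewrite rmorphXn sqr_ge0.
Qed.

Lemma sos_convex_ge_tangent p x y : sos_convex p ->
  peval p x + (gradient p x *m (y - x)^T) 0 0 <= peval p y.
Proof.
move=> cvx_p; have := peval_sos_ge0 y (sos_taylor1_rest x cvx_p).
by rewrite peval_taylor1_rest; lra.
Qed.

(** At z = x + t (y - x), the tangent inequalities towards [x] and [y] involve
    the slopes - t e and (1 - t) e for the same e; weighting them by 1 - t and t
    eliminates e. *)
Lemma sos_convex_sublevel p x y (t c : R) : sos_convex p -> 0 <= t <= 1 ->
  peval p x <= c -> peval p y <= c -> peval p (x + t *: (y - x)) <= c.
Proof.
move=> cvx_p t01 px py; set z := x + _.
have tanx := sos_convex_ge_tangent z x cvx_p.
have tany := sos_convex_ge_tangent z y cvx_p.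
have xz : x - z = (- t) *: (y - x) by rewrite /z opprD addNKr scaleNr.
have yz : y - z = (1 - t) *: (y - x).
  by rewrite scalerBl scale1r /z opprD addrA.
have dirZ a w :
    (gradient p z *m (a *: w)^T) 0 0 = a * (gradient p z *m w^T) 0 0.
  by rewrite linearZ /= -scalemxAr mxE.
move: tanx tany; rewrite xz yz !dirZ.
set e := (_ *m _) 0 0 => tanx tany.
have /andP[t0 t1] := t01.
have t1' : 0 <= 1 - t by rewrite subr_ge0.
have := ler_wpM2l t1' (le_trans tanx px).
have := ler_wpM2l t0 (le_trans tany py).
lra.
Qed.

End TaylorRest.

(** * First-order optimality *)

(** The difference quotient (p(t) - p(0)) / t is a polynomial in t whose value
    at 0 is [p`_1]; it is nonnegative on ]0, 1], hence also at 0 by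
    continuity. *)
Lemma poly_min_coef1_ge0 (R : realType) (p : {poly R}) :
  (forall t, 0 < t <= 1 -> p.[0] <= p.[t]) -> 0 <= p`_1.
Proof.
move=> pmin; have /factor_theorem[s sE] : root (p - p.[0]%:P) 0.
  by rewrite rootE !hornerE subrr.
have <- : s.[0] = p`_1.
  have := congr1 (fun q : {poly R} => q`_1) sE.
  by rewrite subr0 coefMX coefB coefC subr0 /= horner_coef0.
have s_cvg : horner s t @[t --> 0^'+] --> s.[0].
  by apply: cvg_at_right_filter; exact: continuous_horner.
rewrite -(cvg_lim _ s_cvg)//; apply: limr_ge.
  by apply/cvg_ex; exists s.[0].
near=> t; have t01 : 0 < t <= 1.
  by apply/andP; split; near: t; [exact: nbhs_right_gt|exact: nbhs_right_le].
have := pmin t t01; have := congr1 (horner^~ t) sE.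
rewrite /= !hornerE subr0 => stE.
by case/andP: t01 => t0 _; rewrite -subr_ge0 stE pmulr_lge0.
Unshelve. all: end_near. Qed.

Lemma argmin_gradient_ge0 (R : realType) (n : nat) (f : mpoly n R)
    (A : set 'rV[R]_n) (x y : 'rV[R]_n) :
  argmin A f x -> (forall t, 0 <= t <= 1 -> A (x + t *: (y - x))) ->
  0 <= (gradient f x *m (y - x)^T) 0 0.
Proof.
move=> [_ xmin] segA.
pose phi := line (@idfun R) (fun i => x 0 i) (fun i => (y - x) 0 i) f.
have phiE t : phi.[t] = peval f (x + t *: (y - x)).
  rewrite horner_line /peval /meval; congr mmap.
  by apply: funext => i; rewrite !mxE [t * _]mulrC.
have -> : (gradient f x *m (y - x)^T) 0 0 = phi`_1.
  by rewrite line_coef1 mxE; apply: eq_bigr => i _; rewrite !mxE mulrC.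
apply: poly_min_coef1_ge0 => t /andP[t0 t1].
rewrite !phiE scale0r addr0; apply: xmin; apply: segA.
by rewrite t1 ltW.
Qed.

Section Feasible.
Variables (R : realType) (n m : nat) (q : 'I_m -> nat).
Variables (g : forall i : 'I_m, 'rV[R]_(q i) -> mpoly n R).
Variables (V : forall i : 'I_m, set 'rV[R]_(q i)).
Hypothesis g_sos : forall i v, sos_convex (@g i v).

Lemma feasible_segment x y t : feasible g V x -> feasible g V y ->
  0 <= t <= 1 -> feasible g V (x + t *: (y - x)).
Proof.
move=> Fx Fy t01 i v Vv.
by apply: sos_convex_sublevel => //; [exact: Fx|exact: Fy].
Qed.

Lemma argmin_normal_cone (f : mpoly n R) x :
  argmin (feasible g V) f x -> normal_cone (feasible g V) x (- gradient f x).
Proof.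
move=> xmin y Fy; rewrite mulNmx mxE oppr_le0.
apply: (argmin_gradient_ge0 xmin) => t t01.
by apply: feasible_segment => //; case: xmin.
Qed.

End Feasible.

(** * Degrees *)

Lemma pdeg_le (R : realType) (n : nat) (p : mpoly n R) k :
  (pdeg p <= k)%N = (mmeasure (@mdeg n) p <= k.+1)%N.
Proof. by rewrite /pdeg; case: (mmeasure _ _). Qed.

Lemma pdeg_leD (R : realType) (n : nat) (p r : mpoly n R) k :
  (pdeg p <= k)%N -> (pdeg r <= k)%N -> (pdeg (p + r)%R <= k)%N.
Proof.
rewrite !pdeg_le => pk rk; apply: (leq_trans (mmeasureD_le _ _ _)).
by rewrite geq_max pk.
Qed.

Lemma pdeg_leZ (R : realType) (n : nat) (p : mpoly n R) c k :
  (pdeg p <= k)%N -> (pdeg (c *: p)%R <= k)%N.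
Proof. by rewrite !pdeg_le; apply: leq_trans (mmeasureZ_le _ _ _). Qed.

Lemma pdegC (R : realType) (n : nat) (c : R) : pdeg (mpolyC n c) = 0%N.
Proof. by rewrite /pdeg mmeasureC; case: (c != 0). Qed.

(** * Optimality and sums of squares *)

Theorem theorem2p1 (R : realType) (n m : nat) (q d : 'I_m -> nat)
    (f : mpoly n R)
    (g : forall i : 'I_m, 'rV[R]_(q i) -> mpoly n R)
    (V : forall i : 'I_m, set 'rV[R]_(q i))
    (k0 : nat) (xs : 'rV[R]_n)
    (f_sos : sos_convex f)
    (g_sos : forall (i : 'I_m) (v : 'rV[R]_(q i)), sos_convex (g i v))
    (g_deg : forall (i : 'I_m) (v : 'rV[R]_(q i)), (pdeg (g i v) <= d i)%N)
    (V_compact : forall i : 'I_m, compact (V i))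
    (F_nonempty : feasible g V !=set0)
    (argmin_nonempty : argmin (feasible g V) f !=set0)
    (xs_feasible : feasible g V xs)
    (xs_ncc : normal_cone_condition g V xs)
    (k0_def : smallest_even_ge (maxn (pdeg f) (\max_(i < m) d i)%N) k0) :
  argmin (feasible g V) f xs <->
  exists (v : forall i : 'I_m, 'rV[R]_(q i)) (lambda : 'I_m -> R)
         (sigma0 : mpoly n R),
    [/\ forall i : 'I_m, V i (v i),
        forall i : 'I_m, 0 <= lambda i,
        sos_deg_le k0 sigma0
      & forall x : 'rV[R]_n,
          peval f x - peval f xs
            + \sum_(i < m) lambda i * peval (g i (v i)) x
          = peval sigma0 x].
Proof.
case: k0_def => _ k0_ge _.
split=> [xs_min|[v [lam [s [Vv lam0 [_ [sq sE]] eq_s]]]]].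
  have : multiplier_cone g V xs (- gradient f xs).
    by rewrite -xs_ncc; apply: argmin_normal_cone.
  move=> [lam [v [lamP gradE]]].
  pose s := f - mpolyC n (peval f xs) + \sum_i lam i *: g i (v i).
  exists v, lam, s; split.
  - by move=> i; case: (lamP i).
  - by move=> i; case: (lamP i).
  - split.
      have f_k0 : (pdeg f <= k0)%N by apply: leq_trans k0_ge; apply: leq_maxl.
      apply: pdeg_leD; first by apply: pdeg_leD => //; rewrite -rmorphN pdegC.
      apply: (big_ind (fun r => (pdeg r <= k0)%N)) => [|p r|i _].
      + by rewrite -(rmorph0 (@mpolyC n R)) pdegC.
      + exact: pdeg_leD.
      + apply: pdeg_leZ; apply: leq_trans (g_deg i (v i)) _.
        by apply: leq_trans k0_ge; rewrite leq_max leq_bigmax orbT.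
    rewrite /s -taylor1_rest_lagrangian; first last.
    - by move=> i; case: (lamP i).
    - by rewrite -gradE subrr.
    apply: sosD; first exact: sos_taylor1_rest.
    apply: sos_sum => i; apply: sosZ; first by case: (lamP i).
    exact: sos_taylor1_rest.
  - move=> x; rewrite /s /peval mevalD mevalB mevalC.
    rewrite [meval _ (\sum_i _)]raddf_sum; congr (_ + _).
    by apply: eq_bigr => i _ /=; rewrite mevalZ.
split=> // x Fx; have := eq_s x; have s_ge0 : 0 <= peval s x.
  by apply: peval_sos_ge0; exists sq.
have : \sum_i lam i * peval (g i (v i)) x <= 0.
  by apply: sumr_le0 => i _; rewrite mulr_ge0_le0// Fx.
move: s_ge0; lra.
Qed.
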